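(* Let $A$ be a finite alphabet, $k$ an integer, and $u,x\in A^*$ words such that $|u|\ge k\ge |x|$. Then $$\binom{|u|-|x|}{k-|x|}_q\binom{u}{x}_q=\sum_{t\in A^k}\binom{u}{t}_q\binom{t}{x}_q,$$ where the first factor on the left-hand side is a Gaussian binomial coefficient of integers and the other coefficients are $q$-binomial coefficients of words.
   Context: $A^*$ is the free monoid of finite words over $A$ (with concatenation and empty word $\varepsilon$), $|w|$ is the length of a word $w$, and $A^k$ is the set of words of length $k$. The $q$-binomial coefficient $\binom{u}{v}_q\in\mathbb{N}[q]$ of two words $u,v\in A^*$ is defined recursively by $\binom{u}{\varepsilon}_q=1$, $\binom{\varepsilon}{v}_q=0$ if $v\neq\varepsilon$, and, for all $u,v\in A^*$ and letters $a,b\in A$, $\binom{ua}{vb}_q=q^{|vb|}\binom{u}{vb}_q+\delta_{a,b}\binom{u}{v}_q$, where $\delta_{a,b}$ is the Kronecker delta. The Gaussian binomial coefficient of integers $m\ge r\ge0$ is $\binom{m}{r}_q=\frac{(1-q^m)(1-q^{m-1})\cdots(1-q^{m-r+1})}{(1-q)(1-q^2)\cdots(1-q^r)}\in\mathbb{N}[q]$. *)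

(* Defs.v *)
From mathcomp Require Import all_boot all_order all_algebra.

Set Implicit Arguments.
Unset Strict Implicit.
Unset Printing Implicit Defensive.

Import GRing.Theory.
Local Open Scope ring_scope.

(* The recursion peels off last letters, so it is run on reversed words; the
   lemmas wbin_nil, nil_wbin and wbin_rcons are the defining equations. *)
Fixpoint wbin_rev (A : eqType) (u v : seq A) : {poly nat} :=
  match v, u with
  | [::], _ => 1
  | _ :: _, [::] => 0
  | b :: v', a :: u' =>
      'X^(size v) * wbin_rev u' v + (a == b)%:R * wbin_rev u' v'
  end.

Definition wbin (A : eqType) (u v : seq A) : {poly nat} :=
  wbin_rev (rev u) (rev v).

Lemma wbin_nil (A : eqType) (u : seq A) : wbin u [::] = 1.
Proof. by rewrite /wbin; case: (rev u). Qed.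

Lemma nil_wbin (A : eqType) (v : seq A) : v != [::] -> wbin [::] v = 0.
Proof. by case/lastP: v => // v b _; rewrite /wbin rev_rcons. Qed.

Lemma wbin_rcons (A : eqType) (u v : seq A) (a b : A) :
  wbin (rcons u a) (rcons v b) =
    'X^(size (rcons v b)) * wbin u (rcons v b) + (a == b)%:R * wbin u v.
Proof. by rewrite /wbin !rev_rcons /= size_rev size_rcons. Qed.

Definition gauss_num (m r : nat) : {poly int} :=
  \prod_(i < r) (1 - 'X^(m - i)).

Definition gauss_den (r : nat) : {poly int} :=
  \prod_(i < r) (1 - 'X^(i.+1)).

(* The division is exact and the quotient has nonnegative coefficients
   (gaussbinP), so absz only changes the coefficient type from int to nat. *)
Definition gaussbin (m r : nat) : {poly nat} :=
  map_poly absz (gauss_num m r %/ gauss_den r).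

Lemma gauss_num0 m r : (m < r)%N -> gauss_num m r = 0.
Proof.
by move=> lt_mr; rewrite /gauss_num (bigD1 (Ordinal lt_mr)) //= subnn subrr mul0r.
Qed.

Lemma gauss_den_unit r : lead_coef (gauss_den r) \is a GRing.unit.
Proof.
rewrite /gauss_den lead_coef_prod; apply: rpred_prod => i _.
by rewrite -opprB lead_coefN -[1]/(1%:P) lead_coefXnsubC.
Qed.

Lemma gauss_num_dvd m r :
  exists P : {poly nat}, map_poly Posz P * gauss_den r = gauss_num m r.
Proof.
elim: m r => [|m IHm] [|r]; try by exists 1; rewrite rmorph1 mul1r /gauss_den /gauss_num !big_ord0.
  by exists 0; rewrite rmorph0 mul0r gauss_num0.
have [P defP] := IHm r; have [Q defQ] := IHm r.+1.
exists (P + 'X^(r.+1) * Q).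
rewrite rmorphD rmorphM /= map_polyXn mulrDl -mulrA defQ.
have ->: gauss_den r.+1 = gauss_den r * (1 - 'X^(r.+1)).
  by rewrite /gauss_den big_ord_recr.
have ->: gauss_num m r.+1 = gauss_num m r * (1 - 'X^(m - r)).
  by rewrite /gauss_num big_ord_recr.
have ->: gauss_num m.+1 r.+1 = (1 - 'X^(m.+1)) * gauss_num m r.
  by rewrite /gauss_num big_ord_recl.
rewrite mulrA defP; have [lt_mr|le_rm] := ltnP m r.
  by rewrite gauss_num0 // !(mul0r, mulr0) addr0.
rewrite mulrCA -mulrDr mulrC; congr (_ * _).
by rewrite mulrBr mulr1 -exprD addSn subnKC // addrA subrK.
Qed.

Lemma gaussbinP m r :
  map_poly Posz (gaussbin m r) * gauss_den r = gauss_num m r.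
Proof.
have [P defP] := gauss_num_dvd m r.
rewrite -[RHS]defP /gaussbin -defP Pdiv.IdomainUnit.mulpK ?gauss_den_unit //.
congr (map_poly _ _ * _); apply/polyP => i.
by rewrite coef_map_id0 // coef_map.
Qed.

(* Main.v *)
(* Induction on [u], peeling last letters off [u], [t] and [x]: both sides, as
   functions of [u], [k] and [x], satisfy the same recursion, which on the
   left-hand side is the q-Pascal rule for Gaussian binomials. The induction
   passes through the range [k > size u], where both sides vanish. *)

Require Import Defs.
From mathcomp Require Import all_boot all_order all_algebra.
From mathcomp Require Import ring.

Import GRing.Theory.
Local Open Scope ring_scope.

Lemma gauss_num_recr m r : gauss_num m r.+1 = gauss_num m r * (1 - 'X^(m - r)).
Proof. by rewrite /gauss_num big_ord_recr. Qed.

Lemma gauss_num_recl m r :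
  gauss_num m.+1 r.+1 = (1 - 'X^(m.+1)) * gauss_num m r.
Proof. by rewrite /gauss_num big_ord_recl. Qed.

Lemma gauss_den_recr r : gauss_den r.+1 = gauss_den r * (1 - 'X^(r.+1)).
Proof. by rewrite /gauss_den big_ord_recr. Qed.

Lemma gauss_den_neq0 r : gauss_den r != 0.
Proof.
rewrite -lead_coef_eq0; apply: contraTneq (gauss_den_unit r) => ->.
by rewrite unitr0.
Qed.

(** The nonzero denominator cancels in [{poly int}] and [Posz] is injective. Identities between
    Gaussian binomials can thus be checked over [int], where subtraction is available. *)
Lemma gaussbin_unique m r (P : {poly nat}) :
  map_poly Posz P * gauss_den r = gauss_num m r -> gaussbin m r = P.
Proof.
rewrite -gaussbinP => /(mulIf (gauss_den_neq0 r)) eqP.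
by apply: (@map_inj_poly _ _ Posz) => // i j [].
Qed.

Lemma gaussbin_small m r : (m < r)%N -> gaussbin m r = 0.
Proof.
by move=> lt_mr; apply: gaussbin_unique; rewrite rmorph0 mul0r gauss_num0.
Qed.

Lemma gaussbin0 m : gaussbin m 0 = 1.
Proof.
by apply: gaussbin_unique; rewrite rmorph1 mul1r /gauss_den /gauss_num !big_ord0.
Qed.

(** Over the common denominator [gauss_den r.+1], for [r <= m], this is [(1 - 'X^(r.+1)) + 'X^(r.+1)
    * (1 - 'X^(m - r)) = 1 - 'X^(m.+1)]. *)
Lemma gaussbinS m r :
  gaussbin m.+1 r.+1 = gaussbin m r + 'X^(r.+1) * gaussbin m r.+1.
Proof.
apply: gaussbin_unique; rewrite rmorphD rmorphM /= map_polyXn.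
rewrite mulrDl -mulrA gaussbinP gauss_den_recr mulrA gaussbinP.
rewrite gauss_num_recr gauss_num_recl.
(* For [m < r] the truncated [m - r] breaks this computation, but every term has the factor
   [gauss_num m r = 0]. *)
have [lt_mr|le_rm] := ltnP m r; first by rewrite gauss_num0 //; ring.
have -> : 'X^(m.+1) = 'X^(r.+1) * 'X^(m - r) :> {poly int}.
  by rewrite -exprD addSn subnKC.
ring.
Qed.

Section WordSum.

Local Arguments wbin_rev : simpl never.

Variable A : finType.
Implicit Types (u v x : seq A) (k : nat).

Lemma wbin_rev_nil u : wbin_rev u [::] = 1.
Proof. by case: u. Qed.

Lemma wbin_rev_cons u v (a b : A) :
  wbin_rev (a :: u) (b :: v) =
    'X^((size v).+1) * wbin_rev u (b :: v) + (a == b)%:R * wbin_rev u v.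
Proof. by []. Qed.

Lemma wbin_rev_small u v : (size u < size v)%N -> wbin_rev u v = 0.
Proof.
elim: u v => [|a u IHu] [|b v] // lt_uv.
by rewrite wbin_rev_cons !IHu ?mulr0 ?addr0 // ltnW.
Qed.

Definition wsum k u x : {poly nat} :=
  \sum_(t : k.-tuple A) wbin_rev u t * wbin_rev t x.

Lemma big_tuple_cons k (F : seq A -> {poly nat}) :
  \sum_(t : k.+1.-tuple A) F t = \sum_c \sum_(t : k.-tuple A) F (c :: t).
Proof.
rewrite pair_big /=.
rewrite (reindex (fun p : A * k.-tuple A => cons_tuple p.1 p.2)) //=.
exists (fun t : k.+1.-tuple A => (thead t, behead_tuple t)).
  by move=> [c t] _; congr pair; apply: val_inj.
by move=> t _; apply: val_inj; rewrite /= [in RHS](tuple_eta t).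
Qed.

(** Split each summation word as [c :: t] and expand [wbin_rev (a :: u) (c :: t)]. All these words
    have length [k.+1], so the power of ['X] factors out; the Kronecker delta keeps only [c = a]. *)
Lemma wsum_cons k a u x :
  wsum k.+1 (a :: u) x =
    'X^(k.+1) * wsum k.+1 u x +
    \sum_(t : k.-tuple A) wbin_rev u t * wbin_rev (a :: t) x.
Proof.
rewrite /wsum (big_tuple_cons k (fun t => wbin_rev (a :: u) t * wbin_rev t x)).
rewrite (big_tuple_cons k (fun t => wbin_rev u t * wbin_rev t x)).
under eq_bigr => c _ do under eq_bigr => t _ do
  rewrite wbin_rev_cons size_tuple mulrDl -2!mulrA.
under eq_bigr => c _ do rewrite big_split /= -!big_distrr /=.
rewrite big_split /= -big_distrr /=; congr (_ + _).
rewrite (bigD1 a) //= eqxx mul1r [X in _ + X]big1 ?addr0 // => c.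
by rewrite eq_sym => /negPf->; rewrite mul0r.
Qed.

Lemma wsum_cons_nil k a u :
  wsum k.+1 (a :: u) [::] = 'X^(k.+1) * wsum k.+1 u [::] + wsum k u [::].
Proof.
rewrite wsum_cons; congr (_ + _).
by apply: eq_bigr => t _; rewrite !wbin_rev_nil.
Qed.

(** Expands the factor [wbin_rev (a :: t) (b :: x)] left in the second sum of [wsum_cons]. *)
Lemma wsum_cons_cons k a u b x :
  wsum k.+1 (a :: u) (b :: x) =
    'X^(k.+1) * wsum k.+1 u (b :: x) + 'X^((size x).+1) * wsum k u (b :: x) +
    (a == b)%:R * wsum k u x.
Proof.
rewrite wsum_cons -addrA; congr (_ + _); rewrite !big_distrr -big_split /=.
by apply: eq_bigr => t _; rewrite mulrDr mulrCA [X in _ + X]mulrCA.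
Qed.

Lemma wsum_small k u x : (k < size x)%N -> wsum k u x = 0.
Proof.
by move=> lt_kx; apply: big1 => t _; rewrite (wbin_rev_small t) ?mulr0 ?size_tuple.
Qed.

Lemma wsum0 u : wsum 0 u [::] = 1.
Proof.
rewrite /wsum (big_pred1 [tuple]); first by rewrite !wbin_rev_nil mulr1.
by move=> t; rewrite [t]tuple0 /= eqxx.
Qed.

Lemma gaussbin_wbin_rev k u x : (size x <= k)%N ->
  gaussbin (size u - size x) (k - size x) * wbin_rev u x = wsum k u x.
Proof.
elim: u k x => [|a u IHu] [|k] x le_xk.
- by case: x le_xk => // _; rewrite gaussbin0 wsum0 mul1r.
- rewrite /wsum big1 => [|t _]; last by rewrite wbin_rev_small ?size_tuple ?mul0r.
  case: x le_xk => [|b x] _; first by rewrite gaussbin_small ?mul0r.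
  by rewrite wbin_rev_small ?mulr0.
- by case: x le_xk => // _; rewrite gaussbin0 wsum0 wbin_rev_nil mulr1.
case: x le_xk => [|b x] le_xk.
  rewrite wsum_cons_nil -!IHu //= !subn0 gaussbinS !wbin_rev_nil.
  by rewrite !mulr1 addrC.
rewrite wsum_cons_cons wbin_rev_cons -(IHu _ (b :: x)) // -(IHu _ x) //=.
(* The delta terms agree by induction. What remains is a multiple of the q-Pascal rule, apart from
   the boundary cases [size u <= size x], where everything vanishes, and [size x = k]. *)
rewrite !subSS mulrDr mulrCA [X in _ + X]mulrCA; congr (_ + _).
have [lt_ux|lt_xu] := leqP (size u) (size x).
  case: (leqP (size (b :: x)) k) => [le_xk'|lt_kx].
    by rewrite -IHu // wbin_rev_small ?(mulr0, addr0).
  by rewrite wsum_small // wbin_rev_small // ?(mulr0, addr0).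
have [eq_xk|lt_xk] := eqVneq (size x) k.
  (* Here [b :: x] is longer than the summation words, and both Gaussian binomials have lower index
     0. *)
  subst k; rewrite [wsum _ _ _]wsum_small // mulr0 addr0.
  by rewrite subnn !gaussbin0.
have {le_xk} {}lt_xk : (size x < k)%N by rewrite ltn_neqAle lt_xk.
(* Both indices are now successors, so q-Pascal applies; its power of ['X] times ['X^((size x).+1)]
   is ['X^(k.+1)]. *)
rewrite -(IHu k (b :: x)) //= -(subnSK lt_xu) -(subnSK lt_xk) gaussbinS.
have -> : 'X^(k.+1) = 'X^((size x).+1) * 'X^((k - (size x).+1).+1) :> {poly nat}.
  by rewrite -exprD addnS subnKC.
ring.
Qed.

End WordSum.

Theorem theorem4p1 (A : finType) (k : nat) (u x : seq A)
    (hku : (k <= size u)%N) (hxk : (size x <= k)%N) :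
  gaussbin (size u - size x) (k - size x) * wbin u x =
    \sum_(t : k.-tuple A) wbin u t * wbin t x.
Proof.
rewrite -(size_rev u) -(size_rev x) gaussbin_wbin_rev ?size_rev // /wsum.
(* Reversal permutes the words of length [k], which turns [wsum] on reversed words into the sum of
   [wbin] products. *)
rewrite (reindex_inj (inv_inj (_ : involutive (fun t : k.-tuple A => rev_tuple t)))) //=.
by move=> t; apply: val_inj; rewrite /= revK.
Qed.
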